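(* For every $n\geq 0$, the map $\psi$ restricts to a bijection from $\mathcal{E}_n$ onto the set of Motzkin paths of length $n$ that contain no occurrence of $UU$ and no occurrence of $UD$, where $\mathcal{E}_n$ is the set of Łukasiewicz paths of length $n$ in which every up step $U_k$ ($k\geq1$) is immediately followed by a flat step $F$ and every flat step at positive height is immediately preceded by an up step $U_k$ for some $k\geq1$.
   Context: A Łukasiewicz path of length $n$ is a sequence of $n$ steps from $\{(1,i): i\geq -1\}$ starting at $(0,0)$, ending at $(n,0)$ and never going below the $x$-axis; a Motzkin path is one with steps in $\{U,F,D\}$. Write $D=(1,-1)$, $F=(1,0)$, $U=U_1=(1,1)$, $U_k=(1,k)$; $\epsilon$ is the empty path. The height of a step is the minimal ordinate of its endpoints. Every nonempty Łukasiewicz path is uniquely either $FL$ or $U_kL_1DL_2D\cdots L_kDL$ with $k\geq1$ and $L,L_1,\dots,L_k$ Łukasiewicz paths. The map $\psi$ is defined recursively by $\psi(\epsilon)=\epsilon$, $\psi(FL)=F\psi(L)$, $\psi(U_kL_1DL_2D\cdots L_kDL)=U\psi(L_1)F\psi(L_2)F\cdots F\psi(L_k)D\psi(L)$. *)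

(* Defs.v *)
From mathcomp Require Import all_boot all_order all_algebra.
From mathcomp Require Import zify.
From mathcomp Require Import classical_sets functions.
Set Implicit Arguments.
Unset Strict Implicit.
Unset Printing Implicit Defensive.
Import Order.TTheory GRing.Theory Num.Theory.
Local Open Scope ring_scope.

(* The step (1, i) is represented by the integer i, and a path starting at
   (0, 0) by the sequence of its steps. *)
Definition stepD : int := -1.
Definition stepF : int := 0.
Definition stepU (k : nat) : int := k%:Z.

Definition is_up (s : int) : bool := 1 <= s.

(* Ordinate of the point of p with abscissa i, for i <= size p. *)
Definition ordinate (p : seq int) (i : nat) : int := \sum_(s <- take i p) s.

(* Height of the step of p with index i (numbered from 0). *)
Definition height (p : seq int) (i : nat) : int :=
  Num.min (ordinate p i) (ordinate p i.+1).

Definition lukasiewicz (p : seq int) : Prop :=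
  [/\ forall s, s \in p -> -1 <= s,
      forall i, (i <= size p)%N -> 0 <= ordinate p i
    & ordinate p (size p) = 0].

Definition motzkin (p : seq int) : Prop :=
  lukasiewicz p /\ {subset p <= [:: stepU 1; stepF; stepD]}.

Definition up_then_flat (p : seq int) : Prop :=
  forall i, (i < size p)%N -> is_up p`_i ->
    (i.+1 < size p)%N /\ p`_i.+1 = stepF.

Definition flat_after_up (p : seq int) : Prop :=
  forall i, (i < size p)%N -> p`_i = stepF -> 0 < height p i ->
    (0 < i)%N /\ is_up p`_i.-1.

Definition E_set (n : nat) : set (seq int) :=
  [set p | [/\ size p = n, lukasiewicz p, up_then_flat p & flat_after_up p]]%classic.

Definition motzkin_noUU_noUD (n : nat) : set (seq int) :=
  [set p | [/\ size p = n, motzkin p,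
               ~~ infix [:: stepU 1; stepU 1] p
             & ~~ infix [:: stepU 1; stepD] p]]%classic.

(* join s [:: w1; ...; wk] is w1 s w2 s ... s wk. *)
Fixpoint join (s : int) (ws : seq (seq int)) : seq int :=
  match ws with
  | [::] => [::]
  | [:: w] => w
  | w :: ws' => w ++ s :: join s ws'
  end.

(* Index of the first step of q that ends below the x-axis. *)
Definition passage (q : seq int) : nat :=
  find (fun i => ordinate q i.+1 < 0) (iota 0 (size q)).

(* For q = L_1 D L_2 D ... L_k D L with Lukasiewicz paths L_i and L, each L_i is
   followed by the first step below its starting level; factors k q is
   ([:: L_1; ...; L_k], L). *)
Fixpoint factors (k : nat) (q : seq int) : seq (seq int) * seq int :=
  if k is k'.+1 then
    let: (Ls, L) := factors k' (drop (passage q).+1 q) in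
    (take (passage q) q :: Ls, L)
  else ([::], q).

(* The first argument bounds the recursion depth. *)
Fixpoint psi_rec (m : nat) (p : seq int) : seq int :=
  match m, p with
  | m'.+1, s :: q =>
      if s == stepF then stepF :: psi_rec m' q else
      let: (Ls, L) := factors `|s|%N q in
      stepU 1 :: join stepF (map (psi_rec m') Ls) ++ stepD :: psi_rec m' L
  | _, _ => [::]
  end.

Definition psi (p : seq int) : seq int := psi_rec (size p) p.

(* psi_nil, psi_F and psi_U are the recursive equations of psi;
   lukasiewicz_decomp shows that they determine it on Lukasiewicz paths. *)

Lemma factors_size k q :
  all (fun w => (size w <= size q)%N) (factors k q).1
  && (size (factors k q).2 <= size q)%N.
Proof.
elim: k q => [|k IH] q /=; first by rewrite leqnn.
case: (factors k _) (IH (drop (passage q).+1 q)) => Ls L /= /andP[h1 h2].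
have hd : (size (drop (passage q).+1 q) <= size q)%N by rewrite size_drop leq_subr.
rewrite (leq_trans h2 hd) andbT size_take_min geq_minr /=.
by apply/allP => w /(allP h1) /leq_trans; apply.
Qed.

Lemma psi_recE m p : (size p <= m)%N -> psi_rec m p = psi p.
Proof.
rewrite /psi.
suff H m1 m2 q : (size q <= m1)%N -> (size q <= m2)%N ->
    psi_rec m1 q = psi_rec m2 q by move=> h; exact: H.
elim: m1 m2 q => [|m1 IH] [|m2] [|s q] //=; rewrite !ltnS => h1 h2.
rewrite (IH m2) //; case: ifP => // _.
case: (factors _ q) (factors_size `|s|%N q) => Ls L /= /andP[hs hL].
rewrite (IH m2 L) ?(leq_trans hL) //.
by congr (_ :: join _ _ ++ _); apply/eq_in_map => w /(allP hs) hw;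
  apply: IH; exact: leq_trans hw _.
Qed.

Lemma ordinate_catl p q i : (i <= size p)%N -> ordinate (p ++ q) i = ordinate p i.
Proof. by move=> h; rewrite /ordinate takel_cat. Qed.

Lemma ordinate_catr p q i :
  ordinate (p ++ q) (size p + i) = ordinate p (size p) + ordinate q i.
Proof.
by rewrite /ordinate take_size take_cat ltnNge leq_addr /= addKn big_cat.
Qed.

Lemma ordinateS s p i : ordinate (s :: p) i.+1 = s + ordinate p i.
Proof. by rewrite /ordinate /= big_cons. Qed.

Lemma ordinate0 p : ordinate p 0 = 0.
Proof. by rewrite /ordinate take0 big_nil. Qed.

Lemma passage_cat L q : lukasiewicz L -> passage (L ++ stepD :: q) = size L.
Proof.
case=> _ h0 hL; rewrite /passage size_cat iotaD find_cat /= size_iota add0n.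
rewrite -addn1 ordinate_catr hL ordinateS ordinate0 /= addn0.
case: ifP => // /hasP[i]; rewrite mem_iota add0n /= => hi.
by rewrite ordinate_catl // ltNge h0.
Qed.

Lemma factors_join (Ls : seq (seq int)) (L : seq int) :
  (forall w, w \in Ls -> lukasiewicz w) -> Ls != [::] ->
  factors (size Ls) (join stepD Ls ++ stepD :: L) = (Ls, L).
Proof.
elim: Ls => // w [|w' Ls] IH hLs _.
  rewrite /= passage_cat; last by apply: hLs; rewrite mem_head.
  rewrite take_size_cat //.
  by rewrite -cat_rcons drop_size_cat // size_rcons.
have -> : join stepD [:: w, w' & Ls] ++ stepD :: L =
    w ++ stepD :: (join stepD (w' :: Ls) ++ stepD :: L) by rewrite /= -catA.
have hw : lukasiewicz w by apply: hLs; rewrite mem_head.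
have {}IH : factors (size (w' :: Ls)) (join stepD (w' :: Ls) ++ stepD :: L)
    = (w' :: Ls, L).
  by apply: IH => // v hv; apply: hLs; rewrite inE hv orbT.
rewrite -[size _]/(size (w' :: Ls)).+1; move: (w' :: Ls) IH => ws IH.
rewrite [LHS]/= passage_cat // take_size_cat // -cat_rcons.
by rewrite drop_size_cat ?size_rcons // IH.
Qed.

Lemma psi_nil : psi [::] = [::].
Proof. by []. Qed.

Lemma psi_F L : psi (stepF :: L) = stepF :: psi L.
Proof. by []. Qed.

Lemma psi_U (Ls : seq (seq int)) (L : seq int) :
  (forall w, w \in Ls -> lukasiewicz w) -> Ls != [::] ->
  psi (stepU (size Ls) :: join stepD Ls ++ stepD :: L) =
  stepU 1 :: join stepF (map psi Ls) ++ stepD :: psi L.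
Proof.
move=> hLs Ls0; have hf := factors_join L hLs Ls0.
have := factors_size (size Ls) (join stepD Ls ++ stepD :: L).
rewrite hf /= => /andP[hs hL].
rewrite {1}/psi [size (_ :: _)]/= [LHS]/= ifF; last first.
  by apply/negbTE; case: (Ls) Ls0.
rewrite hf psi_recE //.
by congr (_ :: join _ _ ++ _); apply/eq_in_map => w /(allP hs) /psi_recE.
Qed.

Lemma passage_split (h : nat) q :
  (forall s, s \in q -> -1 <= s) ->
  (forall i, (i <= size q)%N -> 0 <= h.+1%:Z + ordinate q i) ->
  h.+1%:Z + ordinate q (size q) = 0 ->
  exists w r, [/\ q = w ++ stepD :: r, lukasiewicz w,
    forall i, (i <= size r)%N -> 0 <= h%:Z + ordinate r i
    & h%:Z + ordinate r (size r) = 0].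
Proof.
move=> hs hq hend.
have Hex : exists i, (i < size q)%N && (ordinate q i.+1 < 0).
  case: q hs hq hend => [|s q] hs hq hend; first by rewrite ordinate0 in hend.
  exists (size q); rewrite /= ltnSn /= -[X in ordinate _ X]/(size (s :: q)).
  by move/eqP: hend; rewrite addrC addr_eq0 => /eqP ->; rewrite oppr_lt0.
case: (ex_minnP Hex) => i /andP[iq ineg] imin.
have Hle j : (j <= i)%N -> 0 <= ordinate q j.
  case: j => [|j] ji; first by rewrite ordinate0.
  rewrite leNgt; apply/negP => jneg.
  by have := imin j; rewrite (ltn_trans ji iq) jneg leqNgt ji => /(_ isT).
have Ei : ordinate q i.+1 = ordinate q i + q`_i.
  by rewrite /ordinate (take_nth 0) // -cats1 big_cat big_seq1.
have h1 := Hle _ (leqnn i); have h2 := hs _ (mem_nth 0 iq).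
have Eq : q`_i = -1 /\ ordinate q i = 0.
  have A (a b : int) : 0 <= a -> -1 <= b -> a + b < 0 -> b = -1 /\ a = 0 by lia.
  by apply: A => //; rewrite -Ei.
case: Eq => qi oi.
have qE : q = take i q ++ stepD :: drop i.+1 q.
  by rewrite -[LHS](cat_take_drop i) (drop_nth 0) // qi.
have sz : size (take i q) = i by rewrite size_takel // ltnW.
have Et j : (j <= i)%N -> ordinate (take i q) j = ordinate q j.
  by move=> ji; rewrite [in RHS]qE ordinate_catl // sz.
have Ed j : ordinate q (i.+1 + j) = -1 + ordinate (drop i.+1 q) j.
  rewrite [in LHS]qE -[X in (X.+1 + _)%N]sz addSnnS ordinate_catr ordinateS.
  by rewrite sz Et // oi add0r.
have EN (x : int) : h.+1%:Z + (-1 + x) = h%:Z + x.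
  by rewrite addrA -addn1 PoszD addrK.
exists (take i q), (drop i.+1 q); split => //.
- split=> [s /mem_take /hs //|j|]; rewrite sz; last by rewrite Et.
  by move=> ji; rewrite Et // Hle.
- move=> j; rewrite size_drop => jq; rewrite -EN -Ed hq //.
  by rewrite -(subnKC iq) leq_add2l.
- by rewrite -EN -Ed size_drop subnKC.
Qed.

Lemma factors_exist k q :
  (forall s, s \in q -> -1 <= s) ->
  (forall i, (i <= size q)%N -> 0 <= k.+1%:Z + ordinate q i) ->
  k.+1%:Z + ordinate q (size q) = 0 ->
  exists Ls L, [/\ q = join stepD Ls ++ stepD :: L, size Ls = k.+1,
    forall w, w \in Ls -> lukasiewicz w & lukasiewicz L].
Proof.
elim: k q => [|k IH] q hs hq hend;
  have [w [r [Eq hw hr rend]]] := passage_split hs hq hend.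
all: have hsr s : s \in r -> -1 <= s
  by move=> sr; apply: hs; rewrite Eq mem_cat inE sr !orbT.
  exists [:: w], r; split=> //; first by move=> v /[!inE] /eqP ->.
  by split=> // [i /hr|]; [rewrite add0r | rewrite -[LHS]add0r].
have [[|v Ls] [L [Er szLs hLs hL]]] := IH r hsr hr rend; first by [].
exists (w :: v :: Ls), L; split=> //; last 1 first.
- by move=> u; rewrite inE => /predU1P[->|/hLs].
- by rewrite Eq Er /= -catA.
- by rewrite /= -szLs.
Qed.

Lemma lukasiewicz_decomp p : lukasiewicz p -> p != [::] ->
  (exists2 L, lukasiewicz L & p = stepF :: L) \/
  (exists Ls L, [/\ p = stepU (size Ls) :: join stepD Ls ++ stepD :: L,
     Ls != [::], forall w, w \in Ls -> lukasiewicz w & lukasiewicz L]).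
Proof.
case: p => // s q [hs hq hend] _.
have hsq t : t \in q -> -1 <= t by move=> tq; apply: hs; rewrite inE tq orbT.
have hq' i : (i <= size q)%N -> 0 <= s + ordinate q i.
  by move=> iq; rewrite -ordinateS; exact: hq.
rewrite /= ordinateS in hend.
have := hq' 0 isT; rewrite ordinate0 addr0.
case: s hs hq hend hq' => // -[|k] hs hq hend hq' _.
  left; exists q => //; split=> // [i /hq'|]; first by rewrite add0r.
  by rewrite -[LHS]add0r.
right; have [Ls [L [Eq szL hLs hL]]] := factors_exist hsq hq' hend.
by exists Ls, L; split=> //; [rewrite Eq /stepU szL | case: (Ls) szL].
Qed.

(* Main.v *)
(** On a path of E_n, psi is computed by a stack machine reading the steps from
    left to right.  The stack lists, for each open up step U_k, how many of its
    k matching down steps are still to come: U_k pushes k and is sent to U; a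
    down step decrements the top entry and is sent to F, except when it pops the
    entry, where it is sent to D; a flat step is sent to F.  The height of the
    path is the sum of the stack and the height of its image is the size of the
    stack.  In the image, a step F comes from a flat step exactly when it
    follows an up step or lies at height 0, so the image can be decoded, the
    entries of the stack being recovered from right to left. *)
Require Import Defs.
From mathcomp Require Import all_boot all_order all_algebra.
From mathcomp Require Import zify.
From mathcomp Require Import classical_sets functions.

Set Implicit Arguments.
Unset Strict Implicit.
Unset Printing Implicit Defensive.
Import Order.TTheory GRing.Theory Num.Theory.
Local Open Scope ring_scope.

(** * Both sets of paths as local conditions on a left-to-right scan *)

(* h is the starting height of p, and j tells whether p is preceded by an up
   step. *)
Fixpoint run (loc : bool -> int -> int -> bool) (j : bool) (h : int)
    (p : seq int) : bool :=
  if p is s :: q then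
    [&& -1 <= s, 0 <= h, loc j h s & run loc (is_up s) (h + s) q]
  else h == 0.

(** Each condition on E_n is tested at the later of the two steps involved. Since [run] also
    requires [0 <= h], the test [h <= 0] means height 0. *)
Definition locE (j : bool) (h s : int) : bool :=
  (j ==> (s == stepF)) && ((s == stepF) ==> (j || (h <= 0))).

(** Once UU and UD are excluded, only F can follow U. *)
Definition locM (j : bool) (h s : int) : bool :=
  (s \in [:: stepU 1; stepF; stepD]) && (j ==> (s == stepF)).

Lemma run_ge0 loc j h p : run loc j h p -> 0 <= h.
Proof. by case: p => [/eqP->|s q /and4P[]]. Qed.

Lemma runP loc j h p : run loc j h p <->
  [/\ forall s, s \in p -> -1 <= s,
      forall i, (i <= size p)%N -> 0 <= h + ordinate p i,
      h + ordinate p (size p) = 0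
    & forall i, (i < size p)%N ->
        loc (if i is i'.+1 then is_up p`_i' else j) (h + ordinate p i) p`_i].
Proof.
elim: p j h => [|s q IH] j h /=.
  rewrite ordinate0 addr0; split=> [/eqP->|[_ _ /eqP//]]; split=> // i.
  by rewrite leqn0 => /eqP->; rewrite ordinate0.
split=> [/and4P[hs hh hl /IH[h1 h2 h3 h4]]|[h1 h2 h3 h4]].
  split=> [t|[|i] hi||[|i] hi]; rewrite ?ordinate0 ?ordinateS ?addr0 ?addrA //.
  - by rewrite inE => /predU1P[->//|/h1].
  - exact: h2.
  - move: (h4 i hi). by case: i hi.
have hh : 0 <= h by have := h2 0 isT; rewrite ordinate0 addr0.
have hl : loc j h s by have := h4 0 isT; rewrite ordinate0 addr0.
rewrite (h1 s) ?mem_head // hh hl /=; apply/IH; split.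
- by move=> t tq; apply: h1; rewrite inE tq orbT.
- by move=> i hi; rewrite -addrA -ordinateS h2.
- by rewrite -addrA -ordinateS.
- move=> i hi; have := h4 i.+1 hi; rewrite ordinateS addrA /=.
  by case: i hi.
Qed.

Lemma ordinate_nth p i : (i < size p)%N -> ordinate p i.+1 = ordinate p i + p`_i.
Proof. by move=> hi; rewrite /ordinate (take_nth 0) // -cats1 big_cat big_seq1. Qed.

(** A final up step would start below the axis. This settles the end of the path, where [run] no
    longer tests the flag. *)
Lemma lukasiewicz_up_next p i : lukasiewicz p -> (i < size p)%N ->
  is_up p`_i -> (i.+1 < size p)%N.
Proof.
move=> [_ h2 h3] hi; rewrite /is_up ltn_neqAle hi andbT => hup.
apply/eqP => si; have := ordinate_nth hi; rewrite {1}si h3.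
have := h2 i (ltnW hi); lia.
Qed.

Lemma height_flat p i : (i < size p)%N -> p`_i = stepF -> height p i = ordinate p i.
Proof.
by move=> hi pF; rewrite /height ordinate_nth // pF /stepF addr0 minxx.
Qed.

Lemma runE_P p : run locE false 0 p <->
  [/\ lukasiewicz p, up_then_flat p & flat_after_up p].
Proof.
split=> [/runP[h1 h2 h3 h4]|[hL hu hf]].
  have hL : lukasiewicz p.
    by split=> // [i /h2|]; rewrite ?add0r // -[LHS]add0r.
  split=> // i hi.
    move=> iup; have hi1 := lukasiewicz_up_next hL hi iup; split=> //.
    by have := h4 _ hi1; rewrite /locE iup /= => /andP[/eqP].
  move=> pF; rewrite height_flat // => hpos.
  have := h4 _ hi; rewrite /locE pF eqxx add0r leNgt hpos orbF => /andP[_] /=.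
  by case: i {hi pF hpos}.
have [h1 h2 h3] := hL.
apply/runP; split=> // [i hi||i hi]; rewrite ?add0r ?h2 //.
rewrite /locE; apply/andP; split.
  case: i hi => // i hi; apply/implyP => iup.
  by have [_ ->] := hu i (ltnW hi) iup.
apply/implyP => /eqP pF; rewrite leNgt; case: ltP => //=; rewrite ?orbT // => hpos.
have [] := hf i hi pF; first by rewrite height_flat.
by case: (i) => // i0 _ ->.
Qed.

Lemma infix2P (a b : int) (p : seq int) :
  reflect (exists2 i, (i.+1 < size p)%N & p`_i = a /\ p`_i.+1 = b)
          (infix [:: a; b] p).
Proof.
apply: (iffP (@infixP _ [:: a; b] p)) => [[u [v ->]]|[i hi [<- <-]]].
  exists (size u); first by rewrite !size_cat /= !addnS ltnS ltnS leq_addr.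
  by split; rewrite nth_cat ?ltnn ?subnn // ltnNge leqnSn subSnn.
exists (take i p), (drop i.+2 p).
by rewrite /= -(drop_nth 0) // -(drop_nth 0) ?cat_take_drop // ltnW.
Qed.

Lemma is_up_motzkin s : s \in [:: stepU 1; stepF; stepD] ->
  is_up s = (s == stepU 1).
Proof. by rewrite !inE => /or3P[] /eqP->. Qed.

Lemma runM_P p : run locM false 0 p <->
  [/\ motzkin p, ~~ infix [:: stepU 1; stepU 1] p
    & ~~ infix [:: stepU 1; stepD] p].
Proof.
split=> [/runP[h1 h2 h3 h4]|[[hL hs] hUU hUD]].
  have hL : lukasiewicz p.
    by split=> // [i /h2|]; rewrite ?add0r // -[LHS]add0r.
  split.
  - split=> // s /(nthP 0)[i hi <-].
    by have /andP[] := h4 i hi.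
  - apply/infix2P => -[i hi [Ui Ui1]].
    by have := h4 _ hi; rewrite /locM Ui Ui1.
  - apply/infix2P => -[i hi [Ui Ui1]].
    by have := h4 _ hi; rewrite /locM Ui Ui1.
have [h1 h2 h3] := hL.
apply/runP; split=> // [i hi||i hi]; rewrite ?add0r ?h2 //.
rewrite /locM hs ?mem_nth //=; case: i hi => // i hi; apply/implyP => iup.
have Ui : p`_i = stepU 1.
  by apply/eqP; rewrite -is_up_motzkin // hs // mem_nth // ltnW.
have := hs _ (mem_nth 0 hi); rewrite !inE => /or3P[] // /eqP Hn.
  by case/infix2P: hUU; exists i.
by case/infix2P: hUD; exists i.
Qed.

(** * The stack machine and its agreement with [psi] *)

Fixpoint stack_psi (st : seq nat) (p : seq int) : seq int :=
  if p is s :: q then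
    if is_up s then stepU 1 :: stack_psi (`|s|%N :: st) q else
    if s == stepF then stepF :: stack_psi st q else
    if st is k.+2 :: st' then stepF :: stack_psi (k.+1 :: st') q
    else stepD :: stack_psi (behead st) q
  else [::].

(** The top entry counts the factors left to read, so each separating D becomes F and only the
    closing one pops. The hypothesis on [Ls] is what the induction in [stack_psi_cat] supplies. *)
Lemma stack_psi_join (st : seq nat) (Ls : seq (seq int)) (r : seq int) :
  (forall w, w \in Ls -> forall st r,
     stack_psi st (w ++ r) = psi w ++ stack_psi st r) ->
  Ls != [::] ->
  stack_psi (size Ls :: st) (join stepD Ls ++ stepD :: r) =
  join stepF (map psi Ls) ++ stepD :: stack_psi st r.
Proof.
elim: Ls => // w [|v Ls] IH hLs _.
  by rewrite /= hLs ?mem_head.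
rewrite -[join stepD _]/(w ++ stepD :: join stepD (v :: Ls)).
rewrite -[join stepF _]/(psi w ++ stepF :: join stepF (map psi (v :: Ls))).
rewrite -!catA !cat_cons hLs ?mem_head //; congr (_ ++ _).
rewrite -IH // => u hu; apply: hLs.
by rewrite inE hu orbT.
Qed.

(** A Łukasiewicz path leaves the entries below its own untouched. Induction is on the length, since
    the factors are not suffixes. *)
Lemma stack_psi_cat (st : seq nat) (p r : seq int) : lukasiewicz p ->
  stack_psi st (p ++ r) = psi p ++ stack_psi st r.
Proof.
have [m] := ubnP (size p); elim: m st p r => // m IH st p r hm hp.
have [->//|p0] := eqVneq p [::].
case: (lukasiewicz_decomp hp p0) hm => [[L hL ->]|[Ls [L [-> Ls0 hLs hL]]]] hm.
  by rewrite psi_F /= IH.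
have := factors_size (size Ls) (join stepD Ls ++ stepD :: L).
rewrite factors_join //= => /andP[/allP hsz hszL].
have hk : is_up (stepU (size Ls)) by case: (Ls) Ls0.
rewrite psi_U //= hk -!catA !cat_cons.
rewrite stack_psi_join // ?IH //; first exact: leq_ltn_trans hszL _.
by move=> w hw st' r'; apply: IH (hLs w hw); apply: leq_ltn_trans (hsz w hw) _.
Qed.

Lemma psi_stack p : lukasiewicz p -> psi p = stack_psi [::] p.
Proof. by move=> /(stack_psi_cat [::] [::]); rewrite !cats0. Qed.

Lemma size_stack_psi st p : size (stack_psi st p) = size p.
Proof.
elim: p st => //= s q IH st.
by case: ifP => _; [|case: ifP => _; [|case: st => [|[|[|k]] st]]]; rewrite /= IH.
Qed.

(** * The machine as a bijection between the two kinds of scan *)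

Lemma sumn_pos_eq0 (st : seq nat) : 0%N \notin st -> sumn st = 0%N -> st = [::].
Proof. by case: st => [|[|k] st]. Qed.

(** The four moves of the machine, with what [locE] forces on the flag and the stack. *)
Variant first_step_spec (j : bool) (st : seq nat) (q : seq int) : int -> Type :=
| FirstUp k of j = false & run locE true (sumn (k.+1 :: st))%:Z q :
    first_step_spec j st q k.+1%:Z
| FirstFlat of j || (st == [::]) & run locE false (sumn st)%:Z q :
    first_step_spec j st q stepF
| FirstPop st' of j = false & st = 1%N :: st' & run locE false (sumn st')%:Z q :
    first_step_spec j st q stepD
| FirstDecr k st' of j = false & st = k.+2 :: st'
    & run locE false (sumn (k.+1 :: st'))%:Z q :
    first_step_spec j st q stepD.

Lemma first_stepP j (st : seq nat) s q : 0%N \notin st ->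
  run locE j (sumn st)%:Z (s :: q) -> first_step_spec j st q s.
Proof.
move=> st0 /and4P[hs _]; rewrite /locE.
case: s hs => [[|k]|[|k]] // _ /andP[/implyP hj /implyP hF] hr.
- apply: FirstFlat; last by move: hr; rewrite addr0.
  have := hF isT; case: (j) => //= h0; apply/eqP/sumn_pos_eq0 => //.
  by move: h0; lia.
- apply: FirstUp; first by case: (j) hj => // /(_ isT).
  move: hr; rewrite /is_up /=.
  by rewrite -PoszD addnC.
- have jF : j = false by case: (j) hj => // /(_ isT).
  have -> : Negz 0 = stepD by [].
  (* A down step on an empty stack would lead to height -1. *)
  have h0 := run_ge0 hr.
  case: st st0 hr h0 {hF} => [|[|[|k]] st] // st0 hr h0.
    apply: (FirstPop jF (erefl _)); move: hr; congr run.
    by rewrite /= -[Negz 0]/(-1 : int); lia.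
  exact: (FirstDecr jF (erefl _) hr).
Qed.

(** Exactly the up steps are sent to U, so one flag serves both scans. *)
Lemma run_stack_psi j (st : seq nat) p : 0%N \notin st ->
  run locE j (sumn st)%:Z p -> run locM j (size st)%:Z (stack_psi st p).
Proof.
elim: p j st => [|s q IH] j st st0.
  by move=> /eqP[/(sumn_pos_eq0 st0) ->].
move=> /(first_stepP st0)[k -> hr|hj hr|st' -> Est hr|k st' -> Est hr].
- rewrite /= /stepU -PoszD addn1.
  exact: (IH true (k.+1 :: st)).
- by rewrite /= addr0 IH // /locM !implybT.
- move: st0; rewrite Est inE negb_or => /andP[_ st0].
  by rewrite /= /stepD -[_.+1]addn1 PoszD addrK IH.
- move: st0; rewrite Est inE negb_or => /andP[_ st0].
  by rewrite /= addr0 (IH _ (k.+1 :: st')).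
Qed.

(** The image shows only the size of the stack, so equality of the stacks is proved too: the
    induction identifies what follows the first step, which is then undone. *)
Lemma stack_psi_inj j (st st' : seq nat) p p' : 0%N \notin st -> 0%N \notin st' ->
  size st = size st' ->
  run locE j (sumn st)%:Z p -> run locE j (sumn st')%:Z p' ->
  stack_psi st p = stack_psi st' p' -> st = st' /\ p = p'.
Proof.
elim: p j st st' p' => [|s q IH] j st st' p' st0 st0' hsz.
  move=> /eqP[/(sumn_pos_eq0 st0) Est] _ /(congr1 size).
  rewrite !size_stack_psi => /esym/size0nil ->.
  by move: hsz; rewrite Est => /esym/size0nil ->.
case: p' => [_ _ /(congr1 size)|s' q']; first by rewrite !size_stack_psi.
move=> /(first_stepP st0)[k -> hr|hj hr|u -> E hr|k u -> E hr];
  move=> /(first_stepP st0')[k' jF hr'|hj' hr'|u' jF E' hr'|k' u' jF E' hr'];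
  rewrite ?E ?E' /=; move=> // -[] Eq.
- by case: (IH true (k.+1 :: st) (k'.+1 :: st') q') => // [|[-> ->] ->]; rewrite /= ?hsz.
- by case: (IH false st st' q') => // -> ->.
(* Flat step against decrement: with the flag off, the former needs an empty stack and the latter a
   nonempty one. *)
- by move: hj hsz; rewrite E' jF => /= /eqP->.
- rewrite E E' in st0 st0' hsz; case: hsz => hsz.
  by case: (IH false u u' q') => // -> ->.
- by move: hj' hsz; rewrite E => /= /eqP->.
- rewrite E E' in st0 st0' hsz.
  by case: (IH false (k.+1 :: u) (k'.+1 :: u') q') => // -[-> ->] ->.
Qed.

(** Decoding from right to left: the induction yields the stack after the first step, and each case
    undoes one move. *)
Lemma stack_psi_surj j d m : run locM j d m ->
  exists (st : seq nat) p, [/\ 0%N \notin st, (size st)%:Z = d,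
    run locE j (sumn st)%:Z p & stack_psi st p = m].
Proof.
elim: m j d => [|s m IH] j d.
  by move=> /eqP->; exists [::], [::].
move=> /and4P[_ d0 /andP[sM js] /IH[st [p [st0 szst hr <-]]]].
move: sM js szst hr; rewrite !inE => /or3P[] /eqP-> /=.
(* The top entry of the later stack tells which up step pushed it. *)
- case: j => // _; case: st st0 => [|k st] st0 szst hr.
    by move: szst d0; rewrite /stepU /=; lia.
  case: k st0 szst hr => // k st0 szst hr.
  exists st, (k.+1%:Z :: p); split=> //; first by move: szst; rewrite /stepU /=; lia.
  by rewrite /= /locE /= -PoszD addnC.
- rewrite addr0 => _ szst hr.
  (* F is decoded as a flat step if this is allowed, and otherwise as a down step that lowered the
     top entry by one. *)
  have [jst|] := boolP (j || (st == [::])).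
    exists st, (stepF :: p); split=> //=.
    rewrite addr0 hr /locE /= !implybT /= andbT.
    by case/orP: jst => [->//|/eqP->]; rewrite orbT.
  rewrite negb_or => /andP[/negPf jF]; case: st st0 szst hr => // -[|k] st // st0 szst hr _.
  exists (k.+2 :: st), (stepD :: p); split=> //=.
  by rewrite jF.
(* D pops an entry, which must have been 1. *)
- case: j => // _ szst hr.
  exists (1%N :: st), (stepD :: p); split=> //=.
    by move: szst; rewrite /stepD; lia.
  by rewrite /stepD PoszD addrAC subrr add0r.
Qed.

Theorem theorem11 (n : nat) : set_bij (E_set n) (motzkin_noUU_noUD n) psi.
Proof.
have hE p : E_set n p <-> size p = n /\ run locE false (sumn [::])%:Z p.
  split=> [[hn h1 h2 h3]|[hn /runE_P[h1 h2 h3]]]; last by split.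
  by split=> //; apply/runE_P.
have hM p : motzkin_noUU_noUD n p <-> size p = n /\ run locM false 0 p.
  split=> [[hn h1 h2 h3]|[hn /runM_P[h1 h2 h3]]]; last by split.
  by split=> //; apply/runM_P.
have psiE p : E_set n p -> psi p = stack_psi [::] p.
  by case=> _ hL _ _; exact: psi_stack.
split=> [p hp|p p' /set_mem hp /set_mem hp'|m].
- rewrite psiE //; have /hE[hn hr] := hp; apply/hM; rewrite size_stack_psi.
  by split=> //; apply: run_stack_psi hr.
- rewrite !psiE //; have /hE[_ hr] := hp; have /hE[_ hr'] := hp'.
  by move=> /(stack_psi_inj _ _ _ hr hr')[].
- move=> /hM[hn /stack_psi_surj[st [p [_ /eqP st0 hr Em]]]].
  (* The image starts at height 0, so the decoded initial stack is empty. *)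
  move: st0 hr Em => /nilP-> hr Em.
  have hp : E_set n p by apply/hE; rewrite -hn -Em size_stack_psi.
  by exists p => //; rewrite psiE.
Qed.
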